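(* Let $d_A,d_B\ge 1$, let $U:\mathbb{R}^{d_A}\times\mathbb{R}^{d_B}\to\mathbb{R}$ be differentiable, let $M_A\in\mathbb{R}^{d_A\times d_A}$ be a constant symmetric positive definite matrix, and let $\theta_A\mapsto M_B(\theta_A)$ be a differentiable map from $\mathbb{R}^{d_A}$ to the symmetric positive definite $d_B\times d_B$ real matrices. For $\epsilon\in\mathbb{R}$ let $\Psi_\epsilon$ be the hierarchical generalized leapfrog step on the phase space $\mathbb{R}^{d_A}\times\mathbb{R}^{d_B}\times\mathbb{R}^{d_A}\times\mathbb{R}^{d_B}$ of points $(\theta_A,\theta_B,p_A,p_B)$ defined in the context. Then, for every step size $\epsilon>0$, the map $\Psi_\epsilon$ is (i) symmetric (time-reversible), i.e. $\Psi_\epsilon$ is invertible with $\Psi_\epsilon^{-1}=\Psi_{-\epsilon}$, and (ii) volume-preserving, i.e. it preserves Lebesgue measure on the phase space.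
   Context: Write $\theta=(\theta_A,\theta_B)$ and $p=(p_A,p_B)$ with $\theta_A,p_A\in\mathbb{R}^{d_A}$ and $\theta_B,p_B\in\mathbb{R}^{d_B}$. Define $$\Xi_B(\theta)=-\nabla_{\theta_B}U(\theta)\in\mathbb{R}^{d_B},$$ and $\Xi_A(\theta,p_B)\in\mathbb{R}^{d_A}$ by, for $i=1,\dots,d_A$, $$[\Xi_A(\theta,p_B)]_i=-\partial_{\theta_{A,i}}U(\theta)+\tfrac12\Big(v_B^\top\big[\partial_{\theta_{A,i}}M_B(\theta_A)\big]v_B-\operatorname{tr}\big[M_B(\theta_A)^{-1}\partial_{\theta_{A,i}}M_B(\theta_A)\big]\Big),\qquad v_B=M_B(\theta_A)^{-1}p_B.$$ For $\epsilon\in\mathbb{R}$, the map $\Psi_\epsilon$ sends $(\theta_A,\theta_B,p_A,p_B)$ to $(\theta_A',\theta_B',p_A',p_B')$, computed explicitly by the following steps in order: 1. $\hat p_B=p_B+\tfrac{\epsilon}{2}\,\Xi_B(\theta_A,\theta_B)$; 2. $\hat p_A=p_A+\tfrac{\epsilon}{2}\,\Xi_A(\theta_A,\theta_B,\hat p_B)$; 3. $\theta_A'=\theta_A+\epsilon\,M_A^{-1}\hat p_A$; 4. $\theta_B'=\theta_B+\tfrac{\epsilon}{2}\big(M_B(\theta_A)^{-1}+M_B(\theta_A')^{-1}\big)\hat p_B$; 5. $p_B'=\hat p_B+\tfrac{\epsilon}{2}\,\Xi_B(\theta_A',\theta_B')$; 6. $p_A'=\hat p_A+\tfrac{\epsilon}{2}\,\Xi_A(\theta_A',\theta_B',\hat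 p_B)$. The map $\Psi_{-\epsilon}$ is given by the same formulas with $\epsilon$ replaced by $-\epsilon$. *)

(* Defs.v *)
From HB Require Import structures.
From mathcomp Require Import all_boot all_order all_algebra.
From mathcomp Require Import all_classical all_reals all_analysis.

Set Implicit Arguments.
Unset Strict Implicit.
Unset Printing Implicit Defensive.

Import Order.TTheory GRing.Theory Num.Theory numFieldNormedType.Exports.

Local Open Scope classical_set_scope.
Local Open Scope ring_scope.

Definition mx_display : measure_display -> measure_display.
Proof. exact. Qed.

(* The sigma-algebra generated by the entries M |-> M i j; over a realType
   this is the Borel sigma-algebra of 'M[R]_(m, n). *)
Section measurable_mx.
Context {d : measure_display} {T : measurableType d} {m n : nat}.

Definition entry_sets : set (set 'M[T]_(m, n)) :=
  \bigcup_(ij in [set: 'I_m * 'I_n])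
    preimage_set_system setT (fun M : 'M[T]_(m, n) => M ij.1 ij.2) measurable.

Let mx_set0 : <<s entry_sets >> set0.
Proof. exact: sigma_algebra0. Qed.

Let mx_setC A : <<s entry_sets >> A -> <<s entry_sets >> (~` A).
Proof. exact: sigma_algebraC. Qed.

Let mx_bigcup (F : (set 'M[T]_(m, n))^nat) :
  (forall i, <<s entry_sets >> (F i)) -> <<s entry_sets >> (\bigcup_i F i).
Proof. exact: sigma_algebra_bigcup. Qed.

HB.instance Definition _ := @isMeasurable.Build (mx_display d)
  'M[T]_(m, n) <<s entry_sets >> mx_set0 mx_setC mx_bigcup.

End measurable_mx.

Lemma measurable_entry d (T : measurableType d) m n (i : 'I_m) (j : 'I_n) :
  measurable_fun [set: 'M[T]_(m, n)] (fun M : 'M[T]_(m, n) => M i j).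
Proof.
move=> _ Y mY; rewrite setTI; apply: sub_sigma_algebra.
by exists (i, j) => //; exists Y => //; rewrite setTI.
Qed.

Lemma measurable_fun_mxP d d' (S : measurableType d) (T : measurableType d')
    m n (f : S -> 'M[T]_(m, n)) :
  measurable_fun [set: S] f <->
  forall i j, measurable_fun [set: S] (fun x => f x i j).
Proof.
split=> [mf i j|mf].
  exact: (measurableT_comp (measurable_entry i j) mf).
apply: (@measurability _ _ _ _ setT f (@entry_sets _ T m n)) => //.
move=> _ [_ [[i j] _ [Y mY <-]] <-]; rewrite setTI.
have := mf i j measurableT Y mY.
by rewrite !setTI.
Qed.

(* The library's canonical instance only applies to subprobabilities. *)
Lemma product_sigma_finite d1 d2 (T1 : measurableType d1)
    (T2 : measurableType d2) (R : realType)
    (m1 : {sigma_finite_measure set T1 -> \bar R})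
    (m2 : {sigma_finite_measure set T2 -> \bar R}) :
  sigma_finite setT (m1 \x m2)%E.
Proof.
have /sigma_finiteP[F [TF ndF Foo]] := sigma_finiteT m1.
have /sigma_finiteP[G [TG ndG Goo]] := sigma_finiteT m2.
exists (fun n => F n `*` G n).
  rewrite -setXTT TF TG predeqE => -[x y]; split.
    move=> [/= [n _ Fnx] [k _ Gky]]; exists (maxn n k) => //; split.
    - by move: x Fnx; exact/subsetPset/ndF/leq_maxl.
    - by move: y Gky; exact/subsetPset/ndG/leq_maxr.
  by move=> [n _ []/= ? ?]; split; exists n.
move=> k; have [? ?] := Foo k; have [? ?] := Goo k.
split; first exact: measurableX.
by rewrite product_measure1E// lte_mul_pinfty// ge0_fin_numE.
Qed.

Lemma measurable_box d (T : measurableType d) n (A : 'I_n -> set T) :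
  (forall i, measurable (A i)) ->
  measurable [set v : 'cV[T]_n | forall i, A i (v i ord0)].
Proof.
move=> mA; rewrite (_ : [set v | _] = \bigcap_(i in [set: 'I_n])
    ((fun v : 'cV[T]_n => v i ord0) @^-1` A i)).
  apply: fin_bigcap_measurable => // i _; rewrite -[X in measurable X]setTI.
  exact: measurable_entry.
by apply/seteqP; split => [v /= Av i _|v Av i]; exact: Av.
Qed.

Section lebesgue_cV.
Context {R : realType}.

Definition cV_cons n (xv : measurableTypeR R * 'cV[R]_n) : 'cV[R]_n.+1 :=
  col_mx (xv.1 : R)%:M xv.2.

Definition cV_uncons n (v : 'cV[R]_n.+1) : measurableTypeR R * 'cV[R]_n :=
  (v ord0 ord0, \col_i v (lift ord0 i) ord0).

Lemma cV_cons0 n xv : @cV_cons n xv ord0 ord0 = xv.1.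
Proof.
rewrite /cV_cons (_ : ord0 = lshift n (ord0 : 'I_1)); last exact/val_inj.
by apply: etrans (col_mxEu _ _ _ _) _; rewrite mxE.
Qed.

Lemma cV_consS n xv i : @cV_cons n xv (lift ord0 i) ord0 = xv.2 i ord0.
Proof.
rewrite /cV_cons (_ : lift ord0 i = rshift 1 i); last exact/val_inj.
by apply: etrans (col_mxEd _ _ _ _) _.
Qed.

Lemma cV_consK n : cancel (@cV_cons n) (@cV_uncons n).
Proof.
move=> [x v]; rewrite /cV_uncons cV_cons0; congr (_, _) => /=.
by apply/colP => i; rewrite mxE cV_consS.
Qed.

Lemma measurable_cV_cons n : measurable_fun setT (@cV_cons n).
Proof.
apply/measurable_fun_mxP => i j; rewrite (ord1 j).
have [k ->|->] := unliftP ord0 i.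
- under eq_fun do rewrite cV_consS.
  exact: (measurableT_comp (measurable_entry k ord0) measurable_snd).
- under eq_fun do rewrite cV_cons0.
  exact: measurable_fst.
Qed.

Lemma measurable_cV_uncons n : measurable_fun setT (@cV_uncons n).
Proof.
apply/measurable_fun_pairP; split; first exact: measurable_entry.
apply/measurable_fun_mxP => i j; rewrite /=.
under eq_fun do rewrite mxE.
exact: measurable_entry.
Qed.

Section step.
Variables (n : nat) (mu : {sigma_finite_measure set 'cV[R]_n -> \bar R}).

Definition lebesgue_cV_step : set 'cV[R]_n.+1 -> \bar R :=
  pushforward (lebesgue_measure \x mu)%E (@cV_cons n).

Let step0 : lebesgue_cV_step set0 = 0%E.
Proof. by rewrite /lebesgue_cV_step /pushforward preimage_set0 measure0. Qed.

Let step_ge0 A : (0 <= lebesgue_cV_step A)%E.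
Proof. by rewrite /lebesgue_cV_step /pushforward; exact: measure_ge0. Qed.

Let step_sigma_additive : semi_sigma_additive lebesgue_cV_step.
Proof.
move=> F mF tF mUF; rewrite /lebesgue_cV_step /pushforward preimage_bigcup.
have mpre A : measurable A -> measurable (@cV_cons n @^-1` A).
  by move=> mA; rewrite -[X in measurable X]setTI; exact: measurable_cV_cons.
apply: measure_semi_sigma_additive.
- by move=> i; exact: mpre.
- move=> i j _ _ [xv [/= Fi Fj]]; apply: (tF i j) => //.
  by exists (cV_cons xv).
- by rewrite -preimage_bigcup; exact: mpre.
Qed.

HB.instance Definition _ := isMeasure.Build _ _ _ lebesgue_cV_step
  step0 step_ge0 step_sigma_additive.

Let step_sigma_finite : sigma_finite setT lebesgue_cV_step.
Proof.
have [F TF mF] := product_sigma_finite (@lebesgue_measure R) mu.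
exists (fun k => @cV_uncons n @^-1` F k).
  by rewrite -preimage_bigcup -TF preimage_setT.
move=> k; have [mFk Foo] := mF k; split.
  by rewrite -[X in measurable X]setTI; exact: measurable_cV_uncons.
rewrite /lebesgue_cV_step /pushforward -comp_preimage.
by rewrite (_ : _ \o _ = id)//; apply/funext => xv; exact: cV_consK.
Qed.

HB.instance Definition _ := Measure_isSigmaFinite.Build _ _ _
  lebesgue_cV_step step_sigma_finite.

End step.

(* Lebesgue measure on R^n as the n-fold product of the one-dimensional one;
   lebesgue_cV_box below is its usual characterization. *)
Fixpoint lebesgue_cV n : {sigma_finite_measure set 'cV[R]_n -> \bar R} :=
  if n is n'.+1 then lebesgue_cV_step (lebesgue_cV n') else \d_(0 : 'cV[R]_0).

Lemma lebesgue_cV_box n (A : 'I_n -> set R) :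
  (forall i, measurable (A i)) ->
  lebesgue_cV n [set v | forall i, A i (v i ord0)] =
  (\prod_(i < n) lebesgue_measure (A i))%E.
Proof.
elim: n => [|n IH] in A * => mA.
  by rewrite big_ord0 /= diracE mem_set// => -[].
rewrite big_ord_recl -IH//= /lebesgue_cV_step /pushforward.
rewrite -product_measure1E; [|exact: mA|];
  last exact: (measurable_box (fun i => mA (lift ord0 i))).
congr (_ _); apply/seteqP; split=> [[x v] /= Axv|[x v] /= [Ax Av] i].
  split=> [|i]; first by have := Axv ord0; rewrite cV_cons0.
  by have := Axv (lift ord0 i); rewrite cV_consS.
by have [k ->|->] := unliftP ord0 i; rewrite ?cV_cons0 ?cV_consS.
Qed.

End lebesgue_cV.

Section hierarchical_leapfrog.
Context {R : realType} {dA dB : nat}.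
Implicit Types (thA pA : 'cV[R]_dA) (thB pB : 'cV[R]_dB).

Definition spd n (M : 'M[R]_n) : Prop :=
  M \is symmetricmx /\
  forall x : 'cV[R]_n, x != 0 -> 0 < (x^T *m M *m x) ord0 ord0.

(* Points (theta_A, theta_B, p_A, p_B). *)
Definition phase : Type := ('cV[R]_dA * 'cV[R]_dB * 'cV[R]_dA * 'cV[R]_dB)%type.

Definition lebesgue_phase : set phase -> \bar R :=
  (lebesgue_cV dA \x lebesgue_cV dB \x lebesgue_cV dA \x lebesgue_cV dB)%E.

HB.instance Definition _ := Measure.on lebesgue_phase.

Variables (U : 'cV[R]_dA * 'cV[R]_dB -> R) (MA : 'M[R]_dA)
  (MB : 'cV[R]_dA -> 'M[R]_dB).

Definition XiB thA thB : 'cV[R]_dB :=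
  - \col_i 'D_(delta_mx i ord0) (fun b => U (thA, b)) thB.

Definition XiA thA thB pB : 'cV[R]_dA :=
  \col_i (- 'D_(delta_mx i ord0) (fun a => U (a, thB)) thA +
    2^-1 * (let vB := invmx (MB thA) *m pB in
            let dMB := 'D_(delta_mx i ord0) MB thA in
            (vB^T *m dMB *m vB) ord0 ord0 - \tr (invmx (MB thA) *m dMB))).

Definition Psi (eps : R) (z : phase) : phase :=
  let: (thA, thB, pA, pB) := z in
  let pB1 := pB + (eps / 2) *: XiB thA thB in
  let pA1 := pA + (eps / 2) *: XiA thA thB pB1 in
  let thA' := thA + eps *: (invmx MA *m pA1) in
  let thB' := thB + (eps / 2) *: ((invmx (MB thA) + invmx (MB thA')) *m pB1) in
  let pB' := pB1 + (eps / 2) *: XiB thA' thB' in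
  let pA' := pA1 + (eps / 2) *: XiA thA' thB' pB1 in
  (thA', thB', pA', pB').

End hierarchical_leapfrog.
Arguments phase : clear implicits.
Arguments lebesgue_phase : clear implicits.

Definition measure_preserving d (T : measurableType d) (R : realType)
    (mu : set T -> \bar R) (f : T -> T) : Prop :=
  measurable_fun [set: T] f /\
  forall A, measurable A -> mu (f @^-1` A) = mu A.

(* Main.v *)
(* The step is a composition of seven shears, each adding to one of the four
   blocks a measurable function of the other three; by Fubini and translation
   invariance of Lebesgue measure such a shear preserves the product measure.
   Differentiability only serves measurability: the partial derivatives in Xi_A
   and Xi_B are pointwise limits of difference quotients, which are continuous.
   The word of shears is a palindrome and the inverse of each shear is obtained
   by negating eps, hence reversibility. *)

Require Import Defs.
From HB Require Import structures.
From mathcomp Require Import all_boot all_order all_algebra.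
From mathcomp Require Import all_classical all_reals all_analysis.
From mathcomp Require Import measurable_realfun.

Set Implicit Arguments.
Unset Strict Implicit.
Unset Printing Implicit Defensive.

Import Order.TTheory GRing.Theory Num.Theory numFieldNormedType.Exports.

Local Open Scope classical_set_scope.
Local Open Scope ring_scope.

(** * Measure-preserving maps and sigma-finite product measures *)

Lemma measurable_preimage d1 d2 (T1 : measurableType d1)
    (T2 : measurableType d2) (f : T1 -> T2) (A : set T2) :
  measurable_fun [set: T1] f -> measurable A -> measurable (f @^-1` A).
Proof. by move=> mf mA; rewrite -[X in measurable X]setTI; exact: mf. Qed.

Lemma measure_preserving_comp d (T : measurableType d) (R : realType)
    (mu : set T -> \bar R) (f g : T -> T) :
  measure_preserving mu f -> measure_preserving mu g ->
  measure_preserving mu (g \o f).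
Proof.
move=> [mf pf] [mg pg]; split=> [|A mA]; first exact: measurableT_comp.
by rewrite comp_preimage pf ?pg//; exact: measurable_preimage.
Qed.

(* Under a name of its own, since the sigma-finite instance already attached to
   product measures is restricted to subprobabilities. *)
Definition sigma_finite_product d1 d2 (T1 : measurableType d1)
    (T2 : measurableType d2) (R : realType)
    (m1 : {sigma_finite_measure set T1 -> \bar R})
    (m2 : {sigma_finite_measure set T2 -> \bar R}) :
  set (T1 * T2) -> \bar R := (m1 \x m2)%E.

HB.instance Definition _ d1 d2 (T1 : measurableType d1)
    (T2 : measurableType d2) (R : realType)
    (m1 : {sigma_finite_measure set T1 -> \bar R})
    (m2 : {sigma_finite_measure set T2 -> \bar R}) :=
  Measure.on (sigma_finite_product m1 m2).

HB.instance Definition _ d1 d2 (T1 : measurableType d1)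
    (T2 : measurableType d2) (R : realType)
    (m1 : {sigma_finite_measure set T1 -> \bar R})
    (m2 : {sigma_finite_measure set T2 -> \bar R}) :=
  Measure_isSigmaFinite.Build _ _ _ (sigma_finite_product m1 m2)
    (product_sigma_finite m1 m2).

(** * Skew products over either factor *)

Section skew_product.
Context d1 d2 (T1 : measurableType d1) (T2 : measurableType d2) (R : realType).
Variable m2 : {sigma_finite_measure set T2 -> \bar R}.

(** The product measure integrates over [x] the [m2]-measure of the section at [x], and the section
    of a preimage is the preimage of the section under [f x], so the two integrands agree
    pointwise. *)
Lemma measure_preserving_skewr (m1 : {measure set T1 -> \bar R})
    (f : T1 -> T2 -> T2) :
  measurable_fun setT (fun z => f z.1 z.2) ->
  (forall x, measure_preserving m2 (f x)) ->
  measure_preserving (m1 \x m2)%E (fun z => (z.1, f z.1 z.2)).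
Proof.
move=> mf pf; split=> [|A mA]; first exact: measurable_fun_pair.
apply: eq_integral => x _ /=.
have -> : xsection ((fun z => (z.1, f z.1 z.2)) @^-1` A) x =
    f x @^-1` xsection A x.
  by apply/seteqP; split=> y /=; rewrite /xsection/= !inE.
by rewrite (pf x).2//; exact: measurable_xsection.
Qed.

(** The product measure is defined by sections at [x], whereas this map acts within sections at [y];
    the order of integration is exchanged first. *)
Lemma measure_preserving_skewl (m1 : {sigma_finite_measure set T1 -> \bar R})
    (f : T2 -> T1 -> T1) :
  measurable_fun setT (fun z => f z.2 z.1) ->
  (forall y, measure_preserving m1 (f y)) ->
  measure_preserving (m1 \x m2)%E (fun z => (f z.2 z.1, z.2)).
Proof.
move=> mf pf.
(* Both iterated integrals agree on rectangles, and these values determine the measure by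
   sigma-finiteness. *)
have fubini A : measurable A -> (m1 \x m2)%E A = (m1 \x^ m2)%E A.
  apply: product_measure_unique => B C mB mC; exact: product_measure2E.
have mF : measurable_fun setT (fun z => (f z.2 z.1, z.2)).
  exact: measurable_fun_pair.
split=> // A mA; rewrite !fubini//; last exact: measurable_preimage.
apply: eq_integral => y _ /=.
have -> : ysection ((fun z => (f z.2 z.1, z.2)) @^-1` A) y =
    f y @^-1` ysection A y.
  by apply/seteqP; split=> x /=; rewrite /ysection/= !inE.
by rewrite (pf y).2//; exact: measurable_ysection.
Qed.

End skew_product.

(** * Translations of the line *)

(** Lebesgue measure is determined by its values on half-open intervals, and translation keeps their
    length. *)
Lemma lebesgue_measureD (R : realType) (c : R) :
  measure_preserving (@lebesgue_measure R) (fun x : measurableTypeR R => x + c).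
Proof.
have mD : measurable_fun setT
    (fun x : measurableTypeR R => (x + c : measurableTypeR R)).
  exact: measurable_funD.
split=> // A mA.
rewrite -[LHS]/(pushforward lebesgue_measure
  (fun x : measurableTypeR R => (x + c : measurableTypeR R)) A).
apply/esym/lebesgue_measure_unique => //= _ [[a b]] _ <-.
rewrite /pushforward.
have -> : (fun x : R => x + c) @^-1` `]a, b] = `]a - c, b - c]%classic.
  by apply/seteqP; split=> x /=; rewrite !in_itv/= ltrBlDr lerBrDr.
rewrite !lebesgue_measure_itv/= !lte_fin ltrD2r; case: ifPn => // _.
by rewrite -!EFinB opprB subrKA.
Qed.

(** * Measurability of matrix operations *)

Section measurable_mx_theory.
Context d (T : measurableType d) (R : realType).

Lemma measurable_funmxD m n (f g : T -> 'M[R]_(m, n)) :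
  measurable_fun setT f -> measurable_fun setT g ->
  measurable_fun setT (fun x => f x + g x).
Proof.
move=> /measurable_fun_mxP mf /measurable_fun_mxP mg.
apply/measurable_fun_mxP => i j; under eq_fun do rewrite mxE.
exact: measurable_funD.
Qed.

Lemma measurable_funmxZ m n (k : T -> R) (f : T -> 'M[R]_(m, n)) :
  measurable_fun setT k -> measurable_fun setT f ->
  measurable_fun setT (fun x => k x *: f x).
Proof.
move=> mk /measurable_fun_mxP mf.
apply/measurable_fun_mxP => i j; under eq_fun do rewrite mxE.
exact: measurable_funM.
Qed.

Lemma measurable_funmxN m n (f : T -> 'M[R]_(m, n)) :
  measurable_fun setT f -> measurable_fun setT (fun x => - f x).
Proof.
move=> /measurable_fun_mxP mf.
apply/measurable_fun_mxP => i j; under eq_fun do rewrite mxE.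
exact: measurable_funN.
Qed.

Lemma measurable_funmxM m n p (f : T -> 'M[R]_(m, n)) (g : T -> 'M[R]_(n, p)) :
  measurable_fun setT f -> measurable_fun setT g ->
  measurable_fun setT (fun x => f x *m g x).
Proof.
move=> /measurable_fun_mxP mf /measurable_fun_mxP mg.
apply/measurable_fun_mxP => i j; under eq_fun do rewrite mxE.
by apply: measurable_sum => k; exact: measurable_funM.
Qed.

Lemma measurable_fun_trmx m n (f : T -> 'M[R]_(m, n)) :
  measurable_fun setT f -> measurable_fun setT (fun x => (f x)^T).
Proof.
move=> /measurable_fun_mxP mf.
apply/measurable_fun_mxP => i j; under eq_fun do rewrite mxE.
exact: mf.
Qed.

Lemma measurable_fun_mxtrace n (f : T -> 'M[R]_n) :
  measurable_fun setT f -> measurable_fun setT (fun x => \tr (f x)).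
Proof.
by move=> /measurable_fun_mxP mf; apply: measurable_sum => k; exact: mf.
Qed.

Lemma measurable_fun_determinant n (f : T -> 'M[R]_n) :
  measurable_fun setT f -> measurable_fun setT (fun x => \det (f x)).
Proof.
move=> /measurable_fun_mxP mf; apply: measurable_sum => s.
apply: measurable_funM => //; apply: measurable_prod => i _; exact: mf.
Qed.

Lemma measurable_fun_adjugate n (f : T -> 'M[R]_n) :
  measurable_fun setT f -> measurable_fun setT (fun x => \adj (f x)).
Proof.
move=> /measurable_fun_mxP mf.
apply/measurable_fun_mxP => i j; under eq_fun do rewrite mxE /cofactor.
apply: measurable_funM => //; apply: measurable_fun_determinant.
apply/measurable_fun_mxP => k l; under eq_fun do rewrite !mxE.
exact: mf.
Qed.

(** Inversion is continuous on the open complement of 0, and every function is measurable on the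
    single point 0. *)
Lemma measurable_invr : measurable_fun setT (fun x : R => x^-1).
Proof.
rewrite (_ : setT = [set~ 0] `|` [set 0]); last by rewrite setUC setUv.
apply/measurable_funU => //; first exact: measurableC.
split.
- apply: open_continuous_measurable_fun.
    by apply: closed_openC; exact: closed_eq.
  by move=> x /set_mem /eqP x0; exact: inv_continuous.
- exact: measurable_fun_set1.
Qed.

(** On units the inverse is the adjugate divided by the determinant, both polynomial in the
    entries. *)
Lemma measurable_fun_invmx n (f : T -> 'M[R]_n) :
  measurable_fun setT f -> (forall x, f x \in unitmx) ->
  measurable_fun setT (fun x => invmx (f x)).
Proof.
move=> mf fU; under eq_fun do rewrite /invmx fU.
apply: measurable_funmxZ; last exact: measurable_fun_adjugate.
apply: (measurableT_comp measurable_invr).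
exact: measurable_fun_determinant.
Qed.

End measurable_mx_theory.

(** * Translations of R^n *)

(** Induction on the dimension: in the coordinates of [cV_cons], translation by [c] becomes [h],
    which translates the first coordinate and then the others; each of these is a skew product with
    constant fibre map. *)
Lemma lebesgue_cVD (R : realType) n (c : 'cV[R]_n) :
  measure_preserving (lebesgue_cV n) (+%R^~ c).
Proof.
have mD k (b : 'cV[R]_k) : measurable_fun setT (fun v : 'cV[R]_k => v + b).
  exact: measurable_funmxD.
elim: n c => [|n IH] c.
  (* In dimension 0 there is a single vector, so the translation is the identity. *)
  split=> [|A mA]; [exact: mD|rewrite (_ : _ @^-1` A = A)//].
  by apply/seteqP; split=> v; rewrite /= (flatmx0 (v + c)) (flatmx0 v).
split=> [|A mA]; [exact: mD|rewrite /= /lebesgue_cV_step /pushforward].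
pose h (z : measurableTypeR R * 'cV[R]_n) : measurableTypeR R * 'cV[R]_n :=
  (z.1 + (cV_uncons c).1, z.2 + (cV_uncons c).2).
have hE z : cV_cons z + c = cV_cons (h z).
  apply/colP => i; have [k ->|->] := unliftP ord0 i.
    by rewrite mxE !cV_consS !mxE.
  by rewrite mxE !cV_cons0.
have -> : @cV_cons R n @^-1` (+%R^~ c @^-1` A) = h @^-1` (@cV_cons R n @^-1` A).
  by apply/funext => z; rewrite /preimage/= hE.
suff [_ ->//] : measure_preserving (lebesgue_measure \x lebesgue_cV n)%E h.
  by apply: measurable_preimage mA; exact: measurable_cV_cons.
rewrite (_ : h = (fun z => (z.1, z.2 + (cV_uncons c).2)) \o
    (fun z => (z.1 + (cV_uncons c).1, z.2)))//.
apply: measure_preserving_comp.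
  apply: (@measure_preserving_skewl _ _ _ _ _ (lebesgue_cV n)
    (@lebesgue_measure R) (fun _ x => x + (cV_uncons c).1)).
    exact: measurable_funD.
  by move=> _; exact: lebesgue_measureD.
apply: (@measure_preserving_skewr _ _ _ _ _ (lebesgue_cV n)
  (@lebesgue_measure R) (fun _ x => x + (cV_uncons c).2)) => //.
exact: (measurableT_comp (mD _ _)).
Qed.

(** * Measurability of continuous functions *)

(** The preimage of a set is a union of fibres of [c], and there are only countably many of them. *)
Lemma measurable_fun_countable_comp d d' (T : measurableType d) (C : countType)
    (S : measurableType d') (c : T -> C) (F : C -> S) :
  (forall a, measurable (c @^-1` [set a])) ->
  measurable_fun setT (fun x => F (c x)).
Proof.
move=> mc _ Y mY; rewrite setTI.
rewrite (_ : _ @^-1` Y = \bigcup_(a in F @^-1` Y) (c @^-1` [set a])).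
  rewrite bigcup_mkcond; apply: countable_bigcupT_measurable.
    exact: countableP.
  by move=> a; case: ifP.
by apply/seteqP; split=> [x /= Yx|x /= [a Ya ->//]]; exists (c x).
Qed.

Section continuous_measurable.
Context (R : realType).

(** Index of the half-open grid cube of side [1/(k+1)] that contains [v]. *)
Definition grid_floor n (k : nat) (v : 'cV[R]_n) : 'cV[int]_n :=
  \col_i Num.floor (k.+1%:R * v i ord0).

(** The corner with least coordinates of the cube of index [a]. *)
Definition grid_point n (k : nat) (a : 'cV[int]_n) : 'cV[R]_n :=
  \col_i ((a i ord0)%:~R / k.+1%:R).

(** The fibre is a grid cube, hence a box of half-open intervals. *)
Lemma measurable_grid_floor n k (a : 'cV[int]_n) :
  measurable (@grid_floor n k @^-1` [set a]).
Proof.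
pose A i : set R :=
  `[(a i ord0)%:~R / k.+1%:R, (a i ord0 + 1)%:~R / k.+1%:R[%classic.
rewrite (_ : grid_floor k @^-1` _ =
    [set v : 'cV[R]_n | forall i, A i (v i ord0)]).
  by apply: measurable_box => i; exact: measurable_itv.
have AE i (x : R) : A i x <-> Num.floor (k.+1%:R * x) = a i ord0.
  rewrite /A /= in_itv/= ler_pdivrMr// ltr_pdivlMr// (mulrC x).
  by split=> [/floor_def //|<-]; exact: floor_itv.
apply/seteqP; split=> v /=.
  by move=> va i; apply/AE; rewrite -va mxE.
by move=> Av; apply/colP => i; rewrite mxE; exact/AE.
Qed.

(** Each coordinate is within [1/(k+1)] of that of the corner, and balls of vectors are
    coordinatewise. *)
Lemma cvg_grid_point n (v : 'cV[R]_n) :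
  grid_point k (grid_floor k v) @[k --> \oo] --> v.
Proof.
apply/cvg_ballP => e e0.
have [N _ Ne] := near_infty_natSinv_lt (PosNum e0).
exists N => // k Nk; split=> // i j; rewrite (ord1 j) !mxE.
apply: le_lt_trans (Ne k Nk) => /=.
have /andP[lo hi] := floor_itv (k.+1%:R * v i ord0).
rewrite ger0_norm; last by rewrite subr_ge0 ler_pdivrMr// (mulrC (v i ord0)).
rewrite lerBlDr -[X in X + _]mul1r -mulrDl ler_pdivlMr// (mulrC (v i ord0)).
by rewrite addrC -intrD1 ltW.
Qed.

(* [f] is the pointwise limit of its values at the grid points below the
   argument, and these depend on countably many measurable cells. *)
Lemma continuous_measurable_fun_cVX m n (f : 'cV[R]_m * 'cV[R]_n -> R) :
  continuous f -> measurable_fun setT f.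
Proof.
move=> cf; pose q k (z : 'cV[R]_m * 'cV[R]_n) :=
  (grid_point k (grid_floor k z.1), grid_point k (grid_floor k z.2)).
apply: (@measurable_fun_cvg _ _ _ _ (fun k => f \o q k)) => [k|z _].
  apply: (@measurable_fun_countable_comp _ _ _
    ('cV[int]_m * 'cV[int]_n)%type _
    (fun z => (grid_floor k z.1, grid_floor k z.2))
    (fun a => f (grid_point k a.1, grid_point k a.2))) => -[a b].
  rewrite (_ : _ @^-1` _ = (@grid_floor m k @^-1` [set a]) `*`
      (@grid_floor n k @^-1` [set b])).
    by apply: measurableX; exact: measurable_grid_floor.
  by apply/seteqP; split=> [z /= [-> ->]//|z /= [-> ->]].
apply: (cvg_comp (q^~ z) f _ (cf z)); case: z => x y.
exact: (cvg_pair (@cvg_grid_point _ x) (@cvg_grid_point _ y)).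
Qed.

Lemma continuous_measurable_fun_mx m n p (f : 'cV[R]_m -> 'M[R]_(n, p)) :
  continuous f -> measurable_fun setT f.
Proof.
move=> cf; apply/measurable_fun_mxP => i j.
(* A dummy factor of dimension 0 brings the result on pairs to bear. *)
pose g (z : 'cV[R]_m * 'cV[R]_0) := f z.1 i j.
have mg : measurable_fun setT g.
  apply: continuous_measurable_fun_cVX => z.
  apply: (@continuous_comp _ _ _ (fun z => f z.1)
    (fun M : 'M[R]_(n, p) => M i j)).
    by apply: continuous_comp; [exact: cvg_fst|exact: cf].
  exact: coord_continuous.
have mx0 : measurable_fun setT (fun x : 'cV[R]_m => (x, 0 : 'cV[R]_0)).
  exact: measurable_fun_pair.
exact: (measurableT_comp mg mx0).
Qed.

End continuous_measurable.

(** * Measurability of derivatives *)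

(** Restricting the difference quotient to the steps [1/(k+1)] makes the derivative the limit of a
    sequence, as measurability of limits requires. *)
Lemma derive_cvg_harmonic (R : realType) (V W : normedModType R) (f : V -> W)
    (x v : V) : derivable f x v ->
  k.+1%:R *: (f (k.+1%:R^-1 *: v + x) - f x) @[k --> \oo] --> 'D_v f x.
Proof.
move=> df; have h0 : (k.+1%:R^-1 : R) @[k --> \oo] --> (0 : R)^'.
  (* The steps are nonzero, so they converge in the punctured neighbourhoods of 0. *)
  move=> A /cvg_harmonic [N _ NA]; exists N => // k Nk.
  by apply: NA => //=; rewrite invr_eq0 pnatr_eq0.
have := cvg_comp _ _ h0 df.
rewrite (_ : _ \o _ = fun k => k.+1%:R *: (f (k.+1%:R^-1 *: v + x) - f x))//.
by apply/funext => k /=; rewrite invrK.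
Qed.

Section measurable_derive.
Context (R : realType).

Lemma measurable_fun_derive m n (f : 'cV[R]_m * 'cV[R]_n -> R) v :
  (forall z, differentiable f z) -> measurable_fun setT (fun z => 'D_v f z).
Proof.
move=> df; have mf : measurable_fun setT f.
  apply: continuous_measurable_fun_cVX => z.
  exact: differentiable_continuous.
apply: (@measurable_fun_cvg _ _ _ _
  (fun k z => k.+1%:R *: (f (k.+1%:R^-1 *: v + z) - f z)))
  => [k|z _]; last first.
  by apply: derive_cvg_harmonic; exact: diff_derivable.
apply: measurable_funM => //; apply: measurable_funB => //.
apply: (measurableT_comp mf); apply/measurable_fun_pairP.
by split; exact: measurable_funmxD.
Qed.

Lemma measurable_fun_derive_mx m n p (f : 'cV[R]_m -> 'M[R]_(n, p)) v :
  (forall x, differentiable f x) -> measurable_fun setT (fun x => 'D_v f x).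
Proof.
move=> df; have mf : measurable_fun setT f.
  by apply: continuous_measurable_fun_mx => x; exact: differentiable_continuous.
(* Limits are taken on each real entry, to which convergence passes by continuity of coordinates. *)
apply/measurable_fun_mxP => i j.
apply: (@measurable_fun_cvg _ _ _ _
  (fun k x => (k.+1%:R *: (f (k.+1%:R^-1 *: v + x) - f x)) i j)) => [k|x _].
  apply: (measurableT_comp (measurable_entry i j)).
  apply: measurable_funmxZ => //; apply: measurable_funmxD.
    by apply: (measurableT_comp mf); exact: measurable_funmxD.
  exact: measurable_funmxN.
have dfx := derive_cvg_harmonic (@diff_derivable _ _ _ _ _ v (df x)).
exact: (cvg_comp _ (fun M : 'M[R]_(n, p) => M i j) dfx
  (@coord_continuous _ _ _ i j _)).
Qed.

(** The difference quotients coincide. This lemma and its mirror image turn the partial derivatives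
    of [U] into directional derivatives on the product, which are jointly measurable. *)
Lemma derive_partial2 (V1 V2 W : normedModType R) (f : V1 * V2 -> W) a b v :
  'D_v (fun y => f (a, y)) b = 'D_(0, v) f (a, b).
Proof.
rewrite /derive; apply: (congr1 (fun g : R -> W => lim (g @ 0^'))).
apply/funext => h /=; have E : h *: 0 + a = a by rewrite scaler0 add0r.
by congr (_ *: (f (_, _) - _)); rewrite E.
Qed.

Lemma derive_partial1 (V1 V2 W : normedModType R) (f : V1 * V2 -> W) a b v :
  'D_v (fun x => f (x, b)) a = 'D_(v, 0) f (a, b).
Proof.
rewrite /derive; apply: (congr1 (fun g : R -> W => lim (g @ 0^'))).
apply/funext => h /=; have E : h *: 0 + b = b by rewrite scaler0 add0r.
by congr (_ *: (f (_, _) - _)); rewrite E.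
Qed.

End measurable_derive.

(** * Inverses of positive definite matrices *)

(** A singular [M] kills some nonzero row vector [v] from the left, and the quadratic form then
    vanishes at [v^T]. *)
Lemma spd_unitmx (R : realType) n (M : 'M[R]_n) : spd M -> M \in unitmx.
Proof.
move=> [_ Mpos]; rewrite unitmxE unitfE; apply/det0P => -[v v0 vM].
have := Mpos v^T; rewrite trmxK vM mul0mx mxE ltxx -trmx0 (inj_eq trmx_inj).
by move=> /(_ v0).
Qed.

Lemma measurable_invmx_differentiable (R : realType) m n
    (M : 'cV[R]_m -> 'M[R]_n) :
  (forall a, differentiable M a) -> (forall a, M a \in unitmx) ->
  measurable_fun setT (fun a => invmx (M a)).
Proof.
move=> dM MU; apply: measurable_fun_invmx => //.
apply: continuous_measurable_fun_mx => a; exact: differentiable_continuous.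
Qed.

(** * Shears of product measures *)

Section shear.
Context d (T : measurableType d) (R : realType) (n : nat).

(** On each fibre the map is a translation by the constant vector [g x]. *)
Lemma measure_preserving_shearr (mu : {measure set T -> \bar R})
    (g : T -> 'cV[R]_n) :
  measurable_fun setT g ->
  measure_preserving (mu \x lebesgue_cV n)%E (fun z => (z.1, z.2 + g z.1)).
Proof.
move=> mg; apply: (@measure_preserving_skewr _ _ _ _ _ (lebesgue_cV n)
  mu (fun x v => v + g x)) => [|x]; last exact: lebesgue_cVD.
by apply: measurable_funmxD => //; exact: (measurableT_comp mg).
Qed.

Lemma measure_preserving_shearl
    (mu : {sigma_finite_measure set T -> \bar R}) (g : T -> 'cV[R]_n) :
  measurable_fun setT g ->
  measure_preserving (lebesgue_cV n \x mu)%E (fun z => (z.1 + g z.2, z.2)).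
Proof.
move=> mg; apply: (@measure_preserving_skewl _ _ _ _ _ mu
  (lebesgue_cV n) (fun x v => v + g x)) => [|x]; last exact: lebesgue_cVD.
by apply: measurable_funmxD => //; exact: (measurableT_comp mg).
Qed.

End shear.

(** * Measurability of the force fields *)

Section leapfrog.
Context (R : realType) (dA dB : nat).
Variables (U : 'cV[R]_dA * 'cV[R]_dB -> R) (MA : 'M[R]_dA)
  (MB : 'cV[R]_dA -> 'M[R]_dB).

Lemma measurable_XiB : (forall z, differentiable U z) ->
  measurable_fun setT (fun z => XiB U z.1 z.2).
Proof.
move=> dU; apply: measurable_funmxN; apply/measurable_fun_mxP => i j.
under eq_fun do rewrite mxE derive_partial2 -surjective_pairing.
exact: measurable_fun_derive.
Qed.

Lemma measurable_XiA : (forall z, differentiable U z) ->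
  (forall a, differentiable MB a) -> (forall a, MB a \in unitmx) ->
  measurable_fun setT (fun z : 'cV[R]_dA * 'cV[R]_dB * 'cV[R]_dB =>
    XiA U MB z.1.1 z.1.2 z.2).
Proof.
move=> dU dMB MBU.
have mMBV := measurable_invmx_differentiable dMB MBU.
have mA : measurable_fun setT
    (fun z : 'cV[R]_dA * 'cV[R]_dB * 'cV[R]_dB => z.1.1).
  exact: measurableT_comp.
apply/measurable_fun_mxP => i j; under eq_fun do rewrite mxE.
apply: measurable_funD.
  apply: measurable_funN.
  under eq_fun do rewrite derive_partial1 -surjective_pairing.
  by apply: (measurableT_comp (measurable_fun_derive _ dU)).
apply: measurable_funM => //.
have mV := measurableT_comp mMBV mA.
have mD := measurableT_comp (measurable_fun_derive_mx (delta_mx i ord0) dMB) mA.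
have mv := measurable_funmxM mV (@measurable_snd _ _ _ _).
apply: measurable_funB.
  apply: (measurableT_comp (measurable_entry ord0 ord0)).
  by do 2!apply: measurable_funmxM => //; exact: measurable_fun_trmx.
by apply: measurable_fun_mxtrace; exact: measurable_funmxM.
Qed.

(** * Elementary shears of phase space and the factorization of the step *)

(** Kicks move a momentum, drifts a position. The increment [g], step size included, stays abstract,
    so that each shear is treated once for all its uses. *)
Definition kickB (g : 'cV[R]_dA * 'cV[R]_dB -> 'cV[R]_dB)
    (z : phase R dA dB) : phase R dA dB :=
  (z.1, z.2 + g z.1.1).

Definition kickA (g : 'cV[R]_dA * 'cV[R]_dB * 'cV[R]_dB -> 'cV[R]_dA)
    (z : phase R dA dB) : phase R dA dB :=
  (z.1.1, z.1.2 + g (z.1.1, z.2), z.2).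

Definition driftB (g : 'cV[R]_dA * 'cV[R]_dB -> 'cV[R]_dB)
    (z : phase R dA dB) : phase R dA dB :=
  (z.1.1.1, z.1.1.2 + g (z.1.1.1, z.2), z.1.2, z.2).

Definition driftA (g : 'cV[R]_dA -> 'cV[R]_dA)
    (z : phase R dA dB) : phase R dA dB :=
  (z.1.1.1 + g z.1.2, z.1.1.2, z.1.2, z.2).

(** The blocks read by the increment are left unchanged, so the opposite increment is evaluated at
    the same point; likewise for the next three. *)
Lemma kickBK g h : (forall w, h w = - g w) -> cancel (kickB g) (kickB h).
Proof. by move=> hg [[[a b] p] q]; rewrite /kickB hg addrK. Qed.

Lemma kickAK g h : (forall w, h w = - g w) -> cancel (kickA g) (kickA h).
Proof. by move=> hg [[[a b] p] q]; rewrite /kickA hg addrK. Qed.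

Lemma driftBK g h : (forall w, h w = - g w) -> cancel (driftB g) (driftB h).
Proof. by move=> hg [[[a b] p] q]; rewrite /driftB hg addrK. Qed.

Lemma driftAK g h : (forall w, h w = - g w) -> cancel (driftA g) (driftA h).
Proof. by move=> hg [[[a b] p] q]; rewrite /driftA hg addrK. Qed.

Lemma measure_preserving_kickB g : measurable_fun setT g ->
  measure_preserving (lebesgue_phase R dA dB) (kickB g).
Proof.
move=> mg; apply: (@measure_preserving_shearr _ _ _ _ _ (g \o fst)).
exact: measurableT_comp.
Qed.

(** Products in [phase] nest to the left, so p_A is not an outer factor; with p_B frozen, it is the
    last factor of the remaining three blocks. *)
Lemma measure_preserving_kickA g : measurable_fun setT g ->
  measure_preserving (lebesgue_phase R dA dB) (kickA g).
Proof.
move=> mg; apply: (@measure_preserving_skewl _ _ _ _ _ (lebesgue_cV dB)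
  (sigma_finite_product (sigma_finite_product (lebesgue_cV dA) (lebesgue_cV dB))
    (lebesgue_cV dA))
  (fun pB w => (w.1, w.2 + g (w.1, pB)))) => [|pB].
  apply: measurable_fun_pair; first exact: measurableT_comp.
  apply: measurable_funmxD; first exact: measurableT_comp.
  apply: (measurableT_comp mg); apply: measurable_fun_pair => //.
  exact: measurableT_comp.
apply: (@measure_preserving_shearr _ _ _ _ _ (fun w => g (w, pB))).
by apply: (measurableT_comp mg); exact: measurable_fun_pair.
Qed.

(** Freezing p_B and then p_A leaves a shear of (theta_A, theta_B) along its last factor. *)
Lemma measure_preserving_driftB g : measurable_fun setT g ->
  measure_preserving (lebesgue_phase R dA dB) (driftB g).
Proof.
move=> mg; apply: (@measure_preserving_skewl _ _ _ _ _ (lebesgue_cV dB)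
  (sigma_finite_product (sigma_finite_product (lebesgue_cV dA) (lebesgue_cV dB))
    (lebesgue_cV dA))
  (fun pB w => (w.1.1, w.1.2 + g (w.1.1, pB), w.2))) => [|pB].
  have mAB : measurable_fun setT (fun z : 'cV[R]_dA * 'cV[R]_dB * 'cV[R]_dA *
      'cV[R]_dB => z.1.1) by exact: measurableT_comp.
  have mA := measurableT_comp (@measurable_fst _ _ _ _) mAB.
  have mB := measurableT_comp (@measurable_snd _ _ _ _) mAB.
  apply: measurable_fun_pair; last exact: measurableT_comp.
  apply: (measurable_fun_pair mA); apply: (measurable_funmxD mB).
  by apply: (measurableT_comp mg); apply: (measurable_fun_pair mA).
apply: (@measure_preserving_skewl _ _ _ _ _ (lebesgue_cV dA)
  (sigma_finite_product (lebesgue_cV dA) (lebesgue_cV dB))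
  (fun _ w => (w.1, w.2 + g (w.1, pB)))) => [|_].
  have mA : measurable_fun setT (fun z : 'cV[R]_dA * 'cV[R]_dB * 'cV[R]_dA =>
      z.1.1) by exact: measurableT_comp.
  apply: (measurable_fun_pair mA); apply: measurable_funmxD.
    exact: measurableT_comp.
  by apply: (measurableT_comp mg); apply: (measurable_fun_pair mA).
apply: (@measure_preserving_shearr _ _ _ _ _ (fun w => g (w, pB))).
by apply: (measurableT_comp mg); exact: measurable_fun_pair.
Qed.

(** With p_B and then p_A frozen, the increment is constant and theta_A, now the first of two
    factors, is merely translated. *)
Lemma measure_preserving_driftA g : measurable_fun setT g ->
  measure_preserving (lebesgue_phase R dA dB) (driftA g).
Proof.
move=> mg; apply: (@measure_preserving_skewl _ _ _ _ _ (lebesgue_cV dB)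
  (sigma_finite_product (sigma_finite_product (lebesgue_cV dA) (lebesgue_cV dB))
    (lebesgue_cV dA))
  (fun _ w => (w.1.1 + g w.2, w.1.2, w.2))) => [|_].
  have mAB : measurable_fun setT (fun z : 'cV[R]_dA * 'cV[R]_dB * 'cV[R]_dA *
      'cV[R]_dB => z.1.1) by exact: measurableT_comp.
  have mA := measurableT_comp (@measurable_fst _ _ _ _) mAB.
  have mB := measurableT_comp (@measurable_snd _ _ _ _) mAB.
  have mp : measurable_fun setT (fun z : 'cV[R]_dA * 'cV[R]_dB * 'cV[R]_dA *
      'cV[R]_dB => z.1.2) by exact: measurableT_comp.
  apply: (measurable_fun_pair _ mp); apply: (measurable_fun_pair _ mB).
  by apply: (measurable_funmxD mA); exact: (measurableT_comp mg mp).
apply: (@measure_preserving_skewl _ _ _ _ _ (lebesgue_cV dA)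
  (sigma_finite_product (lebesgue_cV dA) (lebesgue_cV dB))
  (fun pA w => (w.1 + g pA, w.2))) => [|pA].
  apply: measurable_fun_pair; last exact: measurableT_comp.
  apply: measurable_funmxD; first exact: measurableT_comp.
  exact: (measurableT_comp mg).
exact: (@measure_preserving_shearl _ _ _ _ _ (fun _ => g pA)).
Qed.

(* The drift of theta_B, which uses both the old and the new theta_A, is split
   around the drift of theta_A; the last kick of p_A comes before that of p_B
   because it reads the half-step value of p_B. *)
Lemma Psi_shears eps : Psi U MA MB eps =
  kickB (fun w => (eps / 2) *: XiB U w.1 w.2) \o
  kickA (fun w => (eps / 2) *: XiA U MB w.1.1 w.1.2 w.2) \o
  driftB (fun w => (eps / 2) *: (invmx (MB w.1) *m w.2)) \o
  driftA (fun p => eps *: (invmx MA *m p)) \o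
  driftB (fun w => (eps / 2) *: (invmx (MB w.1) *m w.2)) \o
  kickA (fun w => (eps / 2) *: XiA U MB w.1.1 w.1.2 w.2) \o
  kickB (fun w => (eps / 2) *: XiB U w.1 w.2).
Proof.
apply/funext => -[[[a b] p] q].
by rewrite /Psi /kickB /kickA /driftB /driftA/= mulmxDl scalerDr addrA.
Qed.

Lemma PsiK eps : cancel (Psi U MA MB eps) (Psi U MA MB (- eps)).
Proof.
have halfN (V : lmodType R) (v : V) : (- eps / 2) *: v = - ((eps / 2) *: v).
  by rewrite mulNr scaleNr.
(* Only the word for [- eps] is renested to the right, so each [can_comp] pairs the first remaining
   shear of one word with the last of the other. *)
rewrite (Psi_shears (- eps)) -!compA (Psi_shears eps).
apply: can_comp; last by apply: kickBK => w; exact: halfN.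
apply: can_comp; last by apply: kickAK => w; exact: halfN.
apply: can_comp; last by apply: driftBK => w; exact: halfN.
apply: can_comp; last by apply: driftAK => w; exact: scaleNr.
apply: can_comp; last by apply: driftBK => w; exact: halfN.
apply: can_comp; last by apply: kickAK => w; exact: halfN.
by apply: kickBK => w; exact: halfN.
Qed.

End leapfrog.

(** * Reversibility and preservation of Lebesgue measure *)

Theorem theorem3p1 (R : realType) (dA dB : nat)
    (hdA : (1 <= dA)%N) (hdB : (1 <= dB)%N)
    (U : 'cV[R]_dA * 'cV[R]_dB -> R) (MA : 'M[R]_dA)
    (MB : 'cV[R]_dA -> 'M[R]_dB)
    (hU : forall th : 'cV[R]_dA * 'cV[R]_dB, differentiable U th)
    (hMA : spd MA)
    (hMB : forall thA : 'cV[R]_dA, differentiable MB thA)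
    (hMBpos : forall thA : 'cV[R]_dA, spd (MB thA))
    (eps : R) (heps : 0 < eps) :
  (cancel (Psi U MA MB eps) (Psi U MA MB (- eps)) /\
   cancel (Psi U MA MB (- eps)) (Psi U MA MB eps)) /\
  measure_preserving (lebesgue_phase R dA dB) (Psi U MA MB eps).
Proof.
(* The second cancellation is the first one at [- eps], with [eps] read as [- - eps]. *)
split; first by split; [exact: PsiK|rewrite -{2}[eps]opprK; exact: PsiK].
(* Positive definiteness enters through invertibility, which makes the inverse of [MB]
   measurable. *)
have MBU a : MB a \in unitmx by exact: spd_unitmx.
have mMBV := measurable_invmx_differentiable hMB MBU.
have pkB : measure_preserving (lebesgue_phase R dA dB)
    (kickB (fun w => (eps / 2) *: XiB U w.1 w.2)).
  by apply: measure_preserving_kickB; apply: measurable_funmxZ => //;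
    exact: measurable_XiB.
have pkA : measure_preserving (lebesgue_phase R dA dB)
    (kickA (fun w => (eps / 2) *: XiA U MB w.1.1 w.1.2 w.2)).
  by apply: measure_preserving_kickA; apply: measurable_funmxZ => //;
    exact: measurable_XiA.
have pdB : measure_preserving (lebesgue_phase R dA dB)
    (driftB (fun w => (eps / 2) *: (invmx (MB w.1) *m w.2))).
  apply: measure_preserving_driftB; apply: measurable_funmxZ => //.
  by apply: measurable_funmxM => //; exact: (measurableT_comp mMBV).
have pdA : measure_preserving (lebesgue_phase R dA dB)
    (driftA (fun p => eps *: (invmx MA *m p))).
  by apply: measure_preserving_driftA; apply: measurable_funmxZ => //;
    exact: measurable_funmxM.
(* The shears are peeled off in the order in which they act. *)
rewrite Psi_shears; apply: (measure_preserving_comp pkB).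
apply: (measure_preserving_comp pkA); apply: (measure_preserving_comp pdB).
apply: (measure_preserving_comp pdA); apply: (measure_preserving_comp pdB).
exact: (measure_preserving_comp pkA pkB).
Qed.
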